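(* Assume that $\operatorname{cov}(\mathcal{M})=\mathfrak{c}$ and that the cardinal number $\mathfrak{c}$ is regular. Then for every $\mathfrak{c}$-Luzin set $X\subseteq\mathbb{Z}^{\mathbb{N}}$ there is a $\mathfrak{c}$-Luzin set $Y\subseteq\mathbb{Z}^{\mathbb{N}}$ such that all finite powers of $Y$ are Rothberger and the product space $X\times Y$ is not Menger.
   Context: $\mathfrak{c}$ is the cardinality of the real line. $\mathbb{Z}$ is the discrete space of integers and $\mathbb{Z}^{\mathbb{N}}$ has the Tychonoff product topology. $\operatorname{cov}(\mathcal{M})$ is the minimal cardinality of a family of meager subsets of $\mathbb{R}$ that covers $\mathbb{R}$ (replacing $\mathbb{R}$ by $\mathbb{Z}^{\mathbb{N}}$ gives the same cardinal). A set $X\subseteq\mathbb{Z}^{\mathbb{N}}$ is a $\mathfrak{c}$-Luzin set if $|X|\ge\mathfrak{c}$ and $|X\cap M|<\mathfrak{c}$ for every meager set $M\subseteq\mathbb{Z}^{\mathbb{N}}$. A space $X$ is Rothberger if for every sequence $\mathcal{U}_1,\mathcal{U}_2,\dots$ of open covers of $X$ there are $U_1\in\mathcal{U}_1,U_2\in\mathcal{U}_2,\dots$ such that $\{U_n:n\in\mathbb{N}\}$ covers $X$. A space $X$ is Menger if for every sequence $\mathcal{U}_1,\mathcal{U}_2,\dots$ of open covers of $X$ there are finite $\mathcal{F}_1\subseteq\mathcal{U}_1,\mathcal{F}_2\subseteq\mathcal{U}_2,\dots$ such that $\bigcup_n\mathcal{F}_n$ covers $X$. *)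

(* Defs.v *)
From mathcomp Require Import all_boot all_order all_algebra.
From mathcomp Require Import all_classical all_reals all_analysis.

Set Implicit Arguments.
Unset Strict Implicit.
Unset Printing Implicit Defensive.

Local Open Scope classical_set_scope.
Local Open Scope card_scope.

(** * Cardinals

    A cardinal number is represented by a set of that cardinality; the
    continuum is represented by the full set of a [realType]. *)

Definition card_lt T U (A : set T) (B : set U) : Prop :=
  A #<= B /\ ~ (B #<= A).

Definition regular_card T (A : set T) : Prop :=
  infinite_set A /\
  forall F : set (set T),
    card_lt F A -> (forall B, F B -> card_lt B A) ->
    card_lt (\bigcup_(B in F) B) A.

(** * Category *)

Definition nowhere_dense (T : topologicalType) (A : set T) : Prop :=
  interior (closure A) = set0.

Definition meager (T : topologicalType) (M : set T) : Prop :=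
  exists2 N : nat -> set T,
    forall k, nowhere_dense (N k) & M = \bigcup_k N k.

Definition meager_cover (T : topologicalType) (F : set (set T)) : Prop :=
  (forall M, F M -> meager M) /\ \bigcup_(M in F) M = [set: T].

(** For [T] the real line: the cardinality of [A] is cov(M). *)
Definition is_cov_meager (T : topologicalType) U (A : set U) : Prop :=
  (exists2 F : set (set T), meager_cover F & F #= A) /\
  (forall F : set (set T), meager_cover F -> A #<= F).

(** [int] with the discrete topology, and the Tychonoff power. *)
Notation ZN := {ptws nat -> discrete_topology int}.

Definition c_luzin (R : realType) (X : set ZN) : Prop :=
  [set: R] #<= X /\
  forall M : set ZN, meager M -> card_lt (X `&` M) [set: R].

(** * Selection principles *)

Definition open_cover (T : topologicalType) (U : set (set T)) : Prop :=
  (forall A, U A -> open A) /\ \bigcup_(A in U) A = [set: T].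

Definition Rothberger (T : topologicalType) : Prop :=
  forall U : nat -> set (set T), (forall k, open_cover (U k)) ->
  exists2 A : nat -> set T,
    forall k, U k (A k) & \bigcup_k A k = [set: T].

Definition Menger (T : topologicalType) : Prop :=
  forall U : nat -> set (set T), (forall k, open_cover (U k)) ->
  exists2 F : nat -> set (set T),
    forall k, finite_set (F k) /\ F k `<=` U k
    & \bigcup_(A in \bigcup_k F k) A = [set: T].

(* Main.v *)
Require Import Defs.
From mathcomp Require Import all_boot all_order all_algebra.
From mathcomp Require Import all_classical all_reals all_analysis.
From mathcomp Require Import wochoice lra.

Import Order.TTheory GRing.Theory Num.Theory.
Import numFieldNormedType.Exports.

Set Implicit Arguments.
Unset Strict Implicit.
Unset Printing Implicit Defensive.

Local Open Scope classical_set_scope.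
Local Open Scope card_scope.

(* Along a well order of type c, the cardinality of the continuum, choose
   z_i = x_i + f_i with x_i in X, where f_i runs through Z^N, so that z_i is
   Cohen generic over fewer than c codes of open subsets of the powers of Z^N:
   those listed before stage i and their sections at earlier z_j. This is
   possible since c is regular, X is c-Luzin and translates of meager sets are
   meager. By the Kuratowski-Ulam theorem, increasing tuples of the z_i are then
   generic too.

   Let Y consist of the z_i whose stage carries the flag [true]. Given open
   covers U_n of Y^k, some z_g with flag [false] comes after the codes of all
   the covers; select from U_n the set with number z_g(n). For t in Y^k, z_g and
   the coordinates of t form an increasing generic tuple of distinct stages.
   Fixing the coordinates before stage g, this tuple lies in the open set where
   the selection covers t, or in its exterior. The latter is impossible: every
   U_n covers t, so any initial segment of z_g can be continued by the number of
   a set containing t. Finally y - x takes all values in Z^N on X x Y, so the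
   covers of X x Y by the sets {y(n) - x(n) = m} defeat Menger's property. *)

(** * Sets of cardinality less than the continuum *)

Lemma card_setT_leP C T (A : set T) :
  [set: C] #<= A <-> exists2 f : C -> T, injective f & forall x, A (f x).
Proof.
split=> [/card_leP[f]|[f finj fA]].
  exists (fun x => val (f (exist _ x (@mem_set C setT x Logic.I)))) => [x y|x].
    by move=> /val_inj e; case: (inj (mem_set Logic.I) (mem_set Logic.I) e).
  by apply: set_mem; exact: valP.
have : f @` [set: C] #= [set: C] by apply: inj_card_eq => x y _ _; exact: finj.
rewrite card_eq_le => /andP[_ le1].
by apply: card_le_trans le1 (subset_card_le _) => _ [x _ <-].
Qed.

Lemma inj_card_le T U (f : T -> U) (A : set T) (B : set U) :
  {in A &, injective f} -> (forall x, A x -> B (f x)) -> A #<= B.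
Proof.
move=> finj fAB; have := inj_card_eq finj; rewrite card_eq_le => /andP[_ le1].
by apply: card_le_trans le1 (subset_card_le _) => _ [x Ax <-]; exact: fAB.
Qed.

Definition small C T (A : set T) := ~ ([set: C] #<= A).

Lemma small_card_le C T U (A : set T) (B : set U) :
  A #<= B -> small C B -> small C A.
Proof. by move=> AB sB CA; apply: sB; exact: card_le_trans CA AB. Qed.

Lemma small_subset C T (A B : set T) : A `<=` B -> small C B -> small C A.
Proof. by move=> /subset_card_le; exact: small_card_le. Qed.

Lemma small_image C T U (f : T -> U) (A : set T) :
  small C A -> small C (f @` A).
Proof. exact: small_card_le (card_image_le f A). Qed.

Section Regular.
Variables (C : Type) (C_regular : regular_card [set: C]).

(** Regularity concerns subsets of [C]: an injection of [C] into the union would pull the [A i] back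
    to a small family of small sets covering [C]. *)
Lemma small_bigcup I T (S : set I) (A : I -> set T) :
  S #<= [set: C] -> small C S -> (forall i, S i -> small C (A i)) ->
  small C (\bigcup_(i in S) A i).
Proof.
move=> SC sS sA /card_setT_leP[f finj fA].
pose B i := f @^-1` A i.
have [_ /(_ (B @` S))] := C_regular.
case=> [||_]; last first.
- by apply; apply: subset_card_le => x _; have [i Si Aix] := fA x;
    exists (B i) => //; exists i.
- move=> _ [i Si <-]; split; first exact: card_leT.
  apply: (@small_card_le _ _ _ _ (A i)); last exact: sA.
  by apply: card_ge_preimage => x y _ _; exact: finj.
- split; last exact: small_image.
  exact: card_le_trans (card_image_le B S) SC.
Qed.

Lemma card_nat_le : [set: nat] #<= [set: C].
Proof. by apply/infiniteP; case: C_regular. Qed.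

Hypothesis C_pow : [set: set nat] #<= [set: C].

(** Cantor's diagonal argument, applied to an injection of [set nat] into [nat]. *)
Lemma small_nat : small C [set: nat].
Proof.
move=> /(card_le_trans C_pow) /card_setT_leP[g ginj _].
pose D := [set n | exists2 A, g A = n & ~ A n].
have DgD : ~ D (g D) by move=> /[dup] DD [A /ginj ->].
by apply: (DgD); exists D.
Qed.

Lemma small_bigcup_nat T (A : nat -> set T) :
  (forall i, small C (A i)) -> small C (\bigcup_i A i).
Proof.
by move=> sA; apply: small_bigcup => //; [exact: card_nat_le|exact: small_nat].
Qed.

Lemma smallU T (A B : set T) : small C A -> small C B -> small C (A `|` B).
Proof.
move=> sA sB; rewrite -bigcup2E; apply: small_bigcup_nat => -[|[|i]] //=.
by apply: small_subset sA.
Qed.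

Lemma small1 T (x : T) : small C [set x].
Proof.
apply: small_card_le small_nat.
by apply: (@inj_card_le _ _ (fun=> 0%N)) => // y z;
  rewrite !inE => -> ->.
Qed.

End Regular.

(** * Embedding of power sets of countable sets into the real line *)

Lemma set_le_set_nat (T : countType) : [set: set T] #<= [set: set nat].
Proof.
apply/card_setT_leP; exists (fun A => pickle @` A) => // A B.
have sub A' B' : pickle @` A' `<=` pickle @` B' -> A' `<=` B'.
  move=> AB x Ax.
  have /AB[y By /(pcan_inj pickleK) <- //] : (pickle @` A') (pickle x).
  by exists x.
by move=> AB; apply/seteqP; split; apply: sub; rewrite AB.
Qed.

Section TernarySum.
Local Open Scope ring_scope.
Variable R : realType.
Implicit Types A B : set nat.

(** Base 3 with digits 0 and 1: all places after [n] together weigh half of place [n], so distinct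
    sets get distinct limits. *)
Let u A n : R := \sum_(i < n) (`[< A i >])%:R * 3^-1 ^+ i.

Let uS A n : u A n.+1 = u A n + (`[< A n >])%:R * 3^-1 ^+ n.
Proof. by rewrite /u big_ord_recr. Qed.

Let inv3_ge0 n : 0 <= 3^-1 ^+ n :> R.
Proof. by rewrite exprn_ge0 // invr_ge0. Qed.

Let u_mono A m n : (m <= n)%N -> u A m <= u A n.
Proof.
move=> /subnKC <-; elim: (n - m)%N => [|k IH]; first by rewrite addn0.
by rewrite addnS uS; apply: le_trans IH _; rewrite lerDl mulr_ge0.
Qed.

(** [3 / 2 * 3^-1 ^+ n] is the total weight of the places from [n] on. *)
Let v_mono A m n : (m <= n)%N ->
  u A n + 3 / 2 * 3^-1 ^+ n <= u A m + 3 / 2 * 3^-1 ^+ m.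
Proof.
move=> /subnKC <-; elim: (n - m)%N => [|k IH]; first by rewrite addn0.
apply: le_trans IH; rewrite addnS uS exprS.
by have := inv3_ge0 (m + k); case: `[< _ >] => /=; lra.
Qed.

Let u_le A m n : u A m <= u A n + 3 / 2 * 3^-1 ^+ n.
Proof.
have pos k : 0 <= 3 / 2 * 3^-1 ^+ k :> R.
  by rewrite mulr_ge0 // divr_ge0.
have [mn|/ltnW nm] := leqP m n.
  by apply: le_trans (u_mono _ mn) _; rewrite lerDl.
by apply: le_trans (v_mono A nm); rewrite lerDl.
Qed.

Let h A := sup (range (u A)).

Let u_le_h A n : u A n <= h A.
Proof.
by apply: sup_upper_bound; [split; [exists (u A 0), 0|
  exists (u A 0 + 3 / 2 * 3^-1 ^+ 0) => _ [m _ <-]; exact: u_le]|exists n].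
Qed.

Let h_le A n : h A <= u A n + 3 / 2 * 3^-1 ^+ n.
Proof.
by apply: ge_sup; [exists (u A 0), 0|move=> _ [m _ <-]; exact: u_le].
Qed.

Let h_lt A B n : (forall i, (i < n)%N -> A i <-> B i) -> ~ A n -> B n ->
  h A < h B.
Proof.
move=> AB An Bn; apply: le_lt_trans (h_le A n.+1) _.
apply: lt_le_trans (u_le_h B n.+1).
rewrite !uS (asboolF An) (asboolT Bn).
have -> : u A n = u B n.
  by apply: eq_bigr => i _; rewrite (asbool_equiv_eq (AB i (ltn_ord i))).
rewrite exprS; have : 0 < 3^-1 ^+ n :> R by rewrite exprn_gt0 // invr_gt0.
by move=> /=; lra.
Qed.

Lemma set_nat_le_realType : [set: set nat] #<= [set: R].
Proof.
apply/card_setT_leP; exists h => // A B hAB; apply: contrapT => nAB.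
have : exists n, `[< ~ (A n <-> B n) >].
  apply: contrapT => /forallNP E; apply: nAB; apply/seteqP.
  by split=> x; have [] : A x <-> B x by apply: contrapT => /asboolP /E.
case/ex_minnP => n /asboolP nE nmin.
have ltE i : (i < n)%N -> A i <-> B i.
  move=> lin; apply: contrapT => /asboolP /nmin; by rewrite leqNgt lin.
have [An|An] := pselect (A n); have [Bn|Bn] := pselect (B n).
- by case: nE.
- have := @h_lt B A n; rewrite hAB ltxx => H.
  suff: false by []. by apply: H => // i /ltE [? ?].
- have := @h_lt A B n; rewrite hAB ltxx => H.
  suff: false by []. by apply: H.
- by case: nE.
Qed.

End TernarySum.

(** * Well orders *)

Section WellOrder.
Variables (C : eqType) (le : rel C).
Hypothesis le_wo : well_order le.

Lemma well_order_min (P : set C) : P !=set0 ->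
  exists2 m, P m & forall x, P x -> le m x.
Proof.
case=> x Px.
have [|m [[Pm lm] _]] := @le_wo (mem P); first by exists x; exact/mem_set.
by exists m => [|y Py]; [exact: set_mem|apply: lm; exact/mem_set].
Qed.

Lemma well_order_total : total le.
Proof.
move=> x y; have [|m [->|->] lm] := @well_order_min [set x; y].
- by exists x; left.
- by rewrite (lm y) //; right.
- by rewrite (lm x) ?orbT //; left.
Qed.

Lemma well_order_refl : reflexive le.
Proof. by move=> x; have := well_order_total x x; rewrite orbb. Qed.

Lemma well_order_anti : antisymmetric le.
Proof.
move=> x y /andP[xy yx].
have [|z [_ zu]] := @le_wo (mem [set x; y]).
  by exists x; apply/mem_set; left.
have mx : minimum_of le (mem [set x; y]) x.
  split; first by apply/mem_set; left.
  by move=> u /set_mem[]-> //; exact: well_order_refl.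
have my : minimum_of le (mem [set x; y]) y.
  split; first by apply/mem_set; right.
  by move=> u /set_mem[]-> //; exact: well_order_refl.
by rewrite -(zu _ mx) (zu _ my).
Qed.

Lemma well_order_trans : transitive le.
Proof.
move=> y x z xy yz.
have [|m Pm lm] := @well_order_min [set u | [\/ u = x, u = y | u = z]].
  by exists x; constructor 1.
case: Pm => e; subst m.
- by apply: lm; constructor 3.
- by have -> : x = y by apply: well_order_anti; rewrite xy lm //; constructor 1.
- suff -> : z = y by [].
  by apply: well_order_anti; rewrite yz lm //; constructor 2.
Qed.

Definition slt x y := ~~ le y x.

Lemma slt_irr x : slt x x = false.
Proof. by rewrite /slt well_order_refl. Qed.

Lemma sltW x y : slt x y -> le x y.
Proof.
by rewrite /slt => /negbTE yx; have := well_order_total x y; rewrite yx orbF.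
Qed.

Lemma slt_neqle x y : slt x y = (x != y) && le x y.
Proof.
apply/idP/andP => [h|[xy lexy]].
  by split; [apply: contraL h => /eqP ->; rewrite slt_irr|exact: sltW].
by apply/negP => leyx; case/eqP: xy; apply: well_order_anti; rewrite lexy.
Qed.

Lemma le_slt_trans y x z : le x y -> slt y z -> slt x z.
Proof. by move=> xy; apply: contraNN => zx; exact: well_order_trans zx xy. Qed.

Lemma slt_trans : transitive slt.
Proof. by move=> y x z /sltW; exact: le_slt_trans. Qed.

Lemma slt_wf : well_founded slt.
Proof.
move=> x; apply: contrapT => nx.
have [|m nm mle] := @well_order_min [set y | ~ Acc slt y]; first by exists x.
apply: nm; constructor => y; apply: contraPP => /mle my.
by apply/negP; rewrite /slt my.
Qed.

End WellOrder.

(* Below the first element, if any, whose initial segment is not small, all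
   initial segments are small; the well order is pulled back along an
   injection of [C] into this part. *)
Lemma short_well_order (C : eqType) : exists2 le : rel C,
  well_order le & forall x, small C [set y | slt le y x].
Proof.
have [le le_wo] := @well_ordering_principle C.
suff [f finj fs] : exists2 f : C -> C,
    injective f & forall x, small C [set y | slt le y (f x)].
  exists (fun x y => le (f x) (f y)).
    move=> A [a Aa].
    have [|m [y Ay <-] my] := @well_order_min _ _ le_wo (f @` [set x | A x]).
      by exists (f a), a.
    exists y; split=> [|z [Az zl]].
      by split=> // z Az; apply: my; exists z.
    by apply/finj/(well_order_anti le_wo); rewrite my ?zl //; exists z.
  move=> x; apply: small_card_le (fs x).
  by apply: (@inj_card_le _ _ f) => // y z _ _; exact: finj.
have [bad|good] := pselect (exists x, [set: C] #<= [set y | slt le y x]).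
  have [m /card_setT_leP[f finj fm] mmin] := well_order_min le_wo bad.
  exists f => // x Cx; have := fm x.
  by rewrite /= /slt mmin.
by exists id => // x; apply: contra_not good; exists x.
Qed.

Section WfChoice.
Variables (J T : Type) (t0 : T) (lt : J -> J -> Prop).
Hypothesis lt_wf : well_founded lt.
Variable P : J -> (J -> T) -> T -> Prop.
Hypothesis P_ext : forall a z z' x,
  (forall b, lt b a -> z b = z' b) -> P a z x -> P a z' x.
Hypothesis P_ex : forall a z, exists x, P a z x.

(** Outside the predecessors of [a] the partial function is padded with [t0]; [P_ext] makes [P]
    blind to the padding. *)
Lemma wf_choice : exists z : J -> T, forall a, P a z (z a).
Proof.
pose ext a (r : forall b, lt b a -> T) b :=
  if pselect (lt b a) is left h then r b h else t0.
pose F a (r : forall b, lt b a -> T) := sval (cid (P_ex a (ext a r))).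
pose z := Fix lt_wf (fun=> T) F.
have zE a : z a = F a (fun b _ => z b).
  rewrite /z Fix_eq // => x f g fg; congr F.
  by apply: functional_extensionality_dep => y;
    apply: functional_extensionality_dep => h.
exists z => a; rewrite zE /F; case: cid => x /= Px.
by apply: P_ext Px => b ba; rewrite /ext; case: pselect.
Qed.

End WfChoice.

(** * Codes of open sets and generic tuples *)

(* A code is a set of boxes: the box [:: s_1; ..; s_d] stands for the clopen
   set of all (a_1, .., a_d) in (Z^N)^d such that s_i is an initial segment of
   a_i. The boxes of length d in a code thus describe an open subset of
   (Z^N)^d. *)
Definition code := set (seq (seq int)).

Implicit Types (c : code) (a : nat -> int) (Q : seq (seq int)).

Definition starts a (s : seq int) := s == mkseq a (size s).

Definition in_box (zs : seq (nat -> int)) Q := all2 starts zs Q.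

Definition refines Q Q' := all2 (@prefix int) Q Q'.

(** A box of the code itself must refine [Q]; for a code not closed under refinement this can be
    stronger than density of the open set it describes. *)
Definition code_dense d c :=
  forall Q, size Q = d -> exists2 Q', c Q' & refines Q Q'.

Definition sect c a : code := [set Q | exists n, c (mkseq a n :: Q)].

(* Codes the union of an open set with its exterior. *)
Definition decide d c : code :=
  [set Q | size Q = d /\ (c Q \/ forall Q', refines Q Q' -> ~ c Q')].

Lemma starts_mkseq a n : starts a (mkseq a n).
Proof. by rewrite /starts size_mkseq. Qed.

Lemma starts_prefix_mkseq a s n : starts a s -> (size s <= n)%N ->
  prefix s (mkseq a n).
Proof.
move=> /eqP -> ; rewrite size_mkseq => sn; apply/prefixP.
exists (map a (iota (size s) (n - size s))).
by rewrite /mkseq -map_cat -iotaD subnKC.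
Qed.

Lemma starts_prefix a s t : prefix s t -> starts a t -> starts a s.
Proof.
move=> /prefixP[u ->]; rewrite /starts size_cat {1}/mkseq iotaD map_cat.
by rewrite eqseq_cat ?size_map ?size_iota // => /andP[].
Qed.

Lemma in_box_mkseq zs n : in_box zs [seq mkseq a n | a <- zs].
Proof. by elim: zs => //= a zs IH; rewrite starts_mkseq. Qed.

Lemma refines_refl Q : refines Q Q.
Proof. by elim: Q => //= q Q ->; rewrite prefix_refl. Qed.

Lemma refines_size Q Q' : refines Q Q' -> size Q = size Q'.
Proof. by rewrite /refines all2E => /andP[/eqP]. Qed.

Lemma code_dense_decide d c : code_dense d (decide d c).
Proof.
move=> Q sQ.
have [[Q' [QQ' cQ']]|nc] := pselect (exists Q', refines Q Q' /\ c Q').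
  by exists Q' => //; split; [rewrite -(refines_size QQ')|left].
exists Q; last exact: refines_refl.
by split=> //; right => Q' QQ' cQ'; apply: nc; exists Q'.
Qed.

Lemma foldl_sect c zs Q :
  foldl sect c zs Q <-> exists2 B, in_box zs B & c (B ++ Q).
Proof.
elim: zs c => [|a zs IH] c /=.
  by split=> [cQ|[[|//] _]//]; exists [::].
rewrite IH; split=> [[B zB [n cB]]|[[//|s B] /= /andP[/eqP as_ zB] cB]].
  by exists (mkseq a n :: B) => //=; rewrite starts_mkseq.
by exists B => //; exists (size s); rewrite -as_.
Qed.

Section Known.
Variables (J : Type) (lt : rel J) (e : J -> code).
Implicit Type z : J -> nat -> int.

Definition known_step z i (A : set code) : set code :=
  A `|` (\bigcup_(j in [set j | lt j i]) (sect^~ (z j)) @` A `|`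
         \bigcup_d decide d @` A).

(* The codes available at stage [i]: the closure of the codes [e j], [j < i],
   under taking sections at [z j], [j < i], and under [decide]. *)
Definition known z i : set code :=
  \bigcup_n iter n (known_step z i) (e @` [set j | lt j i]).

Lemma known_base z i j : lt j i -> known z i (e j).
Proof. by move=> ji; exists 0%N => //; exists j. Qed.

Lemma known_sect z i j c : lt j i -> known z i c -> known z i (sect c (z j)).
Proof.
move=> ji [n _ nc]; exists n.+1 => //; right; left.
by exists j => //; exists c.
Qed.

Lemma known_foldl z i (s : seq J) c : all (lt^~ i) s -> known z i c ->
  known z i (foldl sect c (map z s)).
Proof.
elim: s c => //= j s IH c /andP[ji si] ic.
by apply: IH => //; exact: known_sect.
Qed.

Lemma known_decide z i d c : known z i c -> known z i (decide d c).
Proof.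
move=> [n _ nc]; exists n.+1 => //; right; right.
by exists d => //; exists c.
Qed.

Lemma known_mono z i j : transitive lt -> lt i j -> known z i `<=` known z j.
Proof.
move=> lt_trans ij c [n _]; elim: n c => [|n IH] c.
  by move=> [k /= ki <-]; apply: known_base; exact: lt_trans ki ij.
case=> [/IH//|[[k /= ki [c' /IH c'j <-]]|[d _ [c' /IH c'j <-]]]].
  by apply: known_sect => //; exact: lt_trans ki ij.
exact: known_decide.
Qed.

(** This locality lets [z i] be chosen by recursion. *)
Lemma known_ext z z' i : (forall j, lt j i -> z j = z' j) ->
  known z i = known z' i.
Proof.
move=> zz'; apply: eq_bigcupr => n _; elim: n => //= n ->.
rewrite /known_step; congr (_ `|` (_ `|` _)).
by apply: eq_bigcupr => j /= ji; rewrite zz'.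
Qed.

Lemma small_known C z i : regular_card [set: C] ->
  ([set: set nat] #<= [set: C])%card -> ([set: J] #<= [set: C])%card ->
  small C [set j | lt j i] -> small C (known z i).
Proof.
move=> C_reg C_pow JC si; apply: small_bigcup_nat => // n.
elim: n => [|n IH] /=; first exact: small_image.
apply: smallU => //; apply: smallU => //.
  apply: small_bigcup => // [|j _]; last exact: small_image.
  exact: card_le_trans (card_leT _) JC.
by apply: small_bigcup_nat => // d; exact: small_image.
Qed.

(** For [d = 0], [z i] lies in every open set with a known dense code; for larger [d], sections of
    dense codes at [z i] stay dense, as in the Kuratowski-Ulam theorem. *)
Definition generic z i := forall c d,
  known z i c -> code_dense d.+1 c -> code_dense d (sect c (z i)).

Variable z : J -> nat -> int.
Hypothesis lt_trans : transitive lt.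
Hypothesis z_generic : forall i, generic z i.

(** Coordinates are fixed one by one: the section at [z i] is again dense, and it is known at the
    later stage [j]. *)
Lemma generic_path i (s : seq J) c : path lt i s ->
  known z i c -> code_dense (size s).+1 c ->
  exists2 Q, c Q & in_box (map z (i :: s)) Q.
Proof.
elim: s i c => [|j s IH] i c /= => [_|/andP[ij js]] ic dc.
  have [[|//] [n cn] _] := z_generic ic dc (erefl : size [::] = 0%N).
  by exists [:: mkseq (z i) n]; rewrite //= starts_mkseq.
have jc : known z j (sect c (z i)).
  exact/known_sect/known_mono/ic.
have [Q [n cQ] zQ] := IH j _ js jc (z_generic ic dc).
by exists (mkseq (z i) n :: Q); rewrite //= starts_mkseq.
Qed.

(** Fixing the points of [s], all before stage [i], leaves a known code; the increasing tuple
    [i :: t] then meets the dense code that decides it. *)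
Lemma generic_decide i (s t : seq J) c :
  all (lt^~ i) s -> path lt i t -> known z i c ->
  exists2 Q, in_box (map z (i :: t)) Q &
    (exists2 B, in_box (map z s) B & c (B ++ Q)) \/
    (forall B Q', in_box (map z s) B -> refines Q Q' -> ~ c (B ++ Q')).
Proof.
move=> si it ic; pose c' := foldl sect c (map z s).
have ic' : known z i (decide (size t).+1 c') by exact/known_decide/known_foldl.
have [Q [sQ cQ] zQ] := generic_path it ic' (@code_dense_decide _ _).
exists Q => //; case: cQ => [/foldl_sect|cQ]; [by left|right].
by move=> B Q' zB /cQ c'Q' cBQ'; apply/c'Q'/foldl_sect; exists B.
Qed.

End Known.

(** * Neighbourhoods in Z^N and in powers of its subspaces *)

Lemma cvg_initial_topology (S : choiceType) (T : topologicalType) (f : S -> T)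
    (F : set_system S) (s : S) : Filter F ->
  (forall U, nbhs (f s) U -> F (f @^-1` U)) -> F --> (s : initial_topology f).
Proof.
move=> FF cv A; rewrite /= nbhs_simpl nbhsE => -[B [[C oC <-] Cs] BA].
by apply: filterS BA _; apply: cv; exact: open_nbhs_nbhs.
Qed.

Lemma open_mkseq_eq n (a : nat -> int) :
  open [set b : ZN | mkseq b n = mkseq a n].
Proof.
elim: n => [|n IH].
  have -> : [set b : ZN | mkseq b 0 = mkseq a 0] = setT by apply/seteqP.
  exact: openT.
have -> : [set b : ZN | mkseq b n.+1 = mkseq a n.+1] =
    [set b : ZN | mkseq b n = mkseq a n] `&`
    @proj nat (fun=> discrete_topology int) n @^-1` [set a n].
  apply/seteqP; split=> b; rewrite /= !mkseqS; first by move=> /rcons_inj[].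
  by move=> [-> /= <-].
apply: openI => //; apply: open_comp; last exact: discrete_open.
by move=> ? _; exact: proj_continuous.
Qed.

Lemma take_mkseq (a : nat -> int) m n : (m <= n)%N ->
  take m (mkseq a n) = mkseq a m.
Proof. by move=> /minn_idPl mn; rewrite /mkseq -map_take take_iota mn. Qed.

(** Convergence of this filter to [t], checked one coordinate at a time, says that every
    neighbourhood of [t] contains such an agreement set. *)
Definition agree_filter (S K : Type) (g : S -> K -> nat -> int) (t : S) :
    set_system S :=
  [set G | exists n, forall t',
    (forall j, mkseq (g t' j) n = mkseq (g t j) n) -> G t'].

Lemma filter_agree S K g t : Filter (@agree_filter S K g t).
Proof.
have mono m n (t' : S) : (m <= n)%N ->
    (forall j, mkseq (g t' j) n = mkseq (g t j) n) ->
    forall j, mkseq (g t' j) m = mkseq (g t j) m.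
  by move=> mn E j; rewrite -!(take_mkseq _ mn) E.
split=> [|G H [m Gm] [n Hn]|G H GH [n Gn]].
- by exists 0%N.
- exists (maxn m n) => b bmn.
  by split; [apply: Gm|apply: Hn]; apply: mono bmn;
    rewrite (leq_maxl, leq_maxr).
- by exists n => b /Gn /GH.
Qed.

Lemma nbhs_mkseqP (a : ZN) A :
  nbhs a A <-> exists n, forall b : ZN, mkseq b n = mkseq a n -> A b.
Proof.
split=> [|[n nA]]; last first.
  rewrite nbhsE; exists [set b : ZN | mkseq b n = mkseq a n] => //.
  by split=> //; exact: open_mkseq_eq.
pose F : set_system ZN := agree_filter (fun b (_ : unit) => b) a.
have FF : Filter F by exact: filter_agree.
suff cv : F --> a by move=> /cv [n nA]; exists n => b ba; exact: nA.
apply/cvg_sup => i; apply: cvg_initial_topology => U aU.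
exists i.+1 => b /(_ tt); rewrite !mkseqS => /rcons_inj[_ bi].
by have := nbhs_singleton aU; rewrite /= /proj /= bi.
Qed.

Lemma nbhs_ptws_ZN (K : Type) (Y : set ZN) (t : {ptws K -> set_type Y}) A :
  nbhs t A -> exists n, forall t' : K -> set_type Y,
    (forall j, mkseq (val (t' j)) n = mkseq (val (t j)) n) -> A t'.
Proof.
pose g (t' : {ptws K -> set_type Y}) j : ZN := val (t' j).
pose F : set_system {ptws K -> set_type Y} := agree_filter g t.
have FF : Filter F by exact: filter_agree.
suff cv : F --> t by move=> /cv.
apply/cvg_sup => i; apply: cvg_initial_topology => U.
rewrite nbhsE => -[B [[C oC <-] Cti] CU].
have /nbhs_mkseqP[n nC] : nbhs (g t i) C by exact: open_nbhs_nbhs.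
by exists n => t' t't; apply/CU/nC/t't.
Qed.

Lemma nowhere_denseP (A : set ZN) : nowhere_dense A <->
  forall s, exists2 s', prefix s s' & forall a, A a -> ~~ starts a s'.
Proof.
have startsE s : starts (nth 0%R s) s.
  by rewrite /starts mkseq_nth.
split=> [nA s|nA].
  (* [s] followed by zeros is not interior to the closure of [A], so some [b] extending [s] has a
     neighbourhood that misses [A]. *)
  have : ~ nbhs (nth 0%R s : ZN) (closure A).
    by move=> sA; have : interior (closure A) (nth 0%R s) by []; rewrite nA.
  move=> /nbhs_mkseqP /forallNP /(_ (size s)) /existsNP[b /not_implyP[bs]].
  move=> /existsNP[V /not_implyP[/nbhs_mkseqP[m mV] AV]].
  exists (mkseq b (maxn m (size s))).
    apply: starts_prefix_mkseq; last exact: leq_maxr.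
    by rewrite /starts bs; exact: startsE.
  move=> a Aa; apply/negP => /eqP; rewrite size_mkseq => ba.
  apply: AV; exists a; split=> //; apply: mV.
  by rewrite -!(take_mkseq _ (leq_maxl m (size s))) ba.
apply/seteqP; split=> // a /nbhs_mkseqP[n nc].
have [s' /prefixP[u s'E] As'] := nA (mkseq a n).
have /nc /(_ [set b | starts b s']) [] : mkseq (nth 0%R s') n = mkseq a n.
  have nle : (n <= size s')%N by rewrite s'E size_cat size_mkseq leq_addr.
  by rewrite -(take_mkseq _ nle) mkseq_nth s'E take_size_cat // size_mkseq.
  apply/nbhs_mkseqP; exists (size s') => b bs'.
  by rewrite /= /starts bs' mkseq_nth.
by move=> b [/As'/negP].
Qed.

(** * Construction of the generic sequence *)

(* Only countably many boxes [Q] witness that a section is not dense, and the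
   set of points failing at [Q] is nowhere dense: this is one half of the
   Kuratowski-Ulam theorem. *)
Lemma meager_sect_not_dense (c : code) d (f : nat -> int) : code_dense d.+1 c ->
  exists2 M : set ZN, meager M &
    [set x : ZN | ~ code_dense d (sect c (fun n => x n + f n)%R)] `<=` M.
Proof.
move=> c_dense.
pose E Q : set ZN := [set x | size Q = d /\
  forall Q', sect c (fun n => x n + f n)%R Q' -> ~ refines Q Q'].
exists (\bigcup_k E (odflt [::] (unpickle k))); last first.
  move=> x /existsNP[Q /not_implyP[sQ nQ]]; exists (pickle Q) => //.
  by rewrite pickleK /=; split=> // Q' cQ' QQ'; apply: nQ; exists Q'.
exists (fun k => E (odflt [::] (unpickle k))) => // k.
move: (odflt _ _) => Q; apply/nowhere_denseP => s.
have [sQ|nsQ] := pselect (size Q = d); last first.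
  by exists s => [|x []//]; exact: prefix_refl.
(* [s] shifted by [f] extends to the first entry [s1] of a box of [c]; shifting [s1] back gives an
   extension of [s] that avoids [E Q]. *)
have [|[//|s1 Q'] cQ' /= /andP[/prefixP[u s1E] QQ']] :=
  c_dense (mkseq (fun n => s`_n + f n)%R (size s) :: Q); first by rewrite /= sQ.
have le_s : (size s <= size s1)%N by rewrite s1E size_cat size_mkseq leq_addr.
exists (mkseq (fun n => s1`_n - f n)%R (size s1)).
  apply: starts_prefix_mkseq => //; apply/eqP.
  apply: (@eq_from_nth _ 0%R); rewrite ?size_mkseq // => n ns.
  by rewrite nth_mkseq // s1E nth_cat size_mkseq ns nth_mkseq // addrK.
move=> x [_ xQ]; apply/negP => /eqP; rewrite size_mkseq => xs1.
apply: (xQ Q' _ QQ'); exists (size s1); rewrite (_ : mkseq _ _ = s1) //.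
apply: (@eq_from_nth _ 0%R); rewrite ?size_mkseq // => n ns1.
have := congr1 (fun s => s`_n)%R xs1; rewrite !nth_mkseq // => <-.
by rewrite subrK.
Qed.

Section Construction.
Variables (R : realType) (R_regular : regular_card [set: R]).
Variables (X : set ZN) (X_luzin : c_luzin R X).

Let R_pow := @set_nat_le_realType R.

Lemma countable_pow_le (T : countType) : [set: set T] #<= [set: R].
Proof. exact: card_le_trans (@set_le_set_nat T) R_pow. Qed.

(* Stage [i] gets a flag, a shift [f_i] and a code. *)
Lemma enum_requests : exists e : R -> bool * (nat -> int) * code,
  forall r, exists i, e i = r.
Proof.
(* Requests are coded by subsets of a countable type, hence injectively by reals; [e] inverts this
   coding. *)
pose graph (r : bool * (nat -> int) * code) :
    set (bool + nat * int + seq (seq int)) := fun x =>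
  match x with
  | inl (inl b) => b = r.1.1
  | inl (inr (n, m)) => r.1.2 n = m
  | inr Q => r.2 Q
  end.
have graph_inj : injective graph.
  move=> [[b f] c] [[b' f'] c'] E; congr (_, _, _).
  - have : graph (b', f', c') (inl (inl b)) by rewrite -E.
    by [].
  - apply/funext => n.
    have : graph (b', f', c') (inl (inr (n, f n))) by rewrite -E.
    by [].
  - by apply/funext => Q; exact: (congr1 (fun A => A (inr Q)) E).
have /card_setT_leP[h hinj _] :=
  countable_pow_le (bool + nat * int + seq (seq int))%type.
exists (fun i => xget (true, cst 0%R, set0) [set r | h (graph r) = i]) => r.
exists (h (graph r)); case: xgetP => [r' _ /hinj/graph_inj //|].
by move=> /(_ r) /=.
Qed.

Lemma ZN_le : [set: nat -> int] #<= [set: R].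
Proof.
apply: card_le_trans (countable_pow_le (nat * int)%type).
apply/card_setT_leP; exists (fun f => [set p : nat * int | f p.1 = p.2]) => //.
move=> f g E; apply/funext => n.
have : [set p : nat * int | g p.1 = p.2] (n, f n) by rewrite -E.
by [].
Qed.

Lemma code_le : [set: code] #<= [set: R].
Proof. exact: countable_pow_le. Qed.

Lemma luzin_not_small : ~ small R X.
Proof. by apply; case: X_luzin. Qed.

Variables (le : rel R) (le_wo : well_order le).
Hypothesis le_small : forall i, small R [set j | slt le j i].
Variable e : R -> bool * (nat -> int) * code.
Hypothesis e_surj : forall r, exists i, e i = r.

Let lt := slt le.
Let ecode i := (e i).2.

(** If stage [i] failed, fewer than continuum many meager sets would cover [X]; each meets [X] in a
    small set, so regularity would make [X] small. *)
Lemma generic_sequence : exists z : R -> nat -> int, forall i,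
  generic lt ecode z i /\
  exists2 x : ZN, X x & z i = (fun n => x n + (e i).1.2 n)%R.
Proof.
pose P i (z : R -> nat -> int) (y : nat -> int) :=
  (forall c d, known lt ecode z i c -> code_dense d.+1 c ->
     code_dense d (sect c y)) /\
  exists2 x : ZN, X x & y = (fun n => x n + (e i).1.2 n)%R.
suff : exists z, forall i, P i z (z i) by [].
apply: (wf_choice (cst 0%R) (slt_wf le_wo)) => [i z z' y zz' [gen yX]|i z].
  by split=> // c d; rewrite -(known_ext ecode zz'); exact: gen.
apply: contrapT => /forallNP noy; apply: luzin_not_small.
pose bad c d := [set x : ZN | code_dense d.+1 c /\
  ~ code_dense d (sect c (fun n => x n + (e i).1.2 n)%R)].
have sub : X `<=` \bigcup_(c in known lt ecode z i) \bigcup_d (X `&` bad c d).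
  move=> x Xx; have := noy (fun n => x n + (e i).1.2 n)%R.
  move=> /not_andP[/existsNP[c /existsNP[d]]|].
    move=> /not_implyP[ic /not_implyP[cd nd]].
    by exists c => //; exists d.
  by move=> []; exists x.
apply: small_subset sub _.
apply: small_bigcup => // [||c _].
- exact: card_le_trans (card_leT _) code_le.
- exact: small_known.
apply: small_bigcup_nat => // d.
have [cd|ncd] := pselect (code_dense d.+1 c); last first.
  apply: small_subset _ (@small1 _ R_pow _ (cst 0%R : ZN)).
  by move=> x [_ []].
have [M M_meager badM] := meager_sect_not_dense (e i).1.2 cd.
have [_ /(_ M M_meager)[_ XM]] := X_luzin.
by apply: small_subset _ XM => x [Xx [_ /badM]].
Qed.

End Construction.

(** * The generic set *)

Lemma in_box_nth zs Q a0 i : in_box zs Q -> (i < size zs)%N ->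
  starts (nth a0 zs i) (nth [::] Q i).
Proof.
elim: zs Q i => [|a zs IH] [|q Q] [|i] //= /andP[aq zsQ] //.
exact: IH.
Qed.

Lemma in_box_cat zs ws Q Q' : in_box zs Q -> in_box ws Q' ->
  in_box (zs ++ ws) (Q ++ Q').
Proof. by elim: zs Q => [|a zs IH] [|q Q] //= /andP[-> /IH]; exact. Qed.

Lemma in_box_refines_mkseq zs Q n : in_box zs Q ->
  (sumn (map size Q) <= n)%N -> refines Q [seq mkseq a n | a <- zs].
Proof.
elim: zs Q => [|a zs IH] [|q Q] //= /andP[aq zsQ] qQn.
rewrite starts_prefix_mkseq //=; last exact: leq_trans (leq_addr _ _) qQn.
by apply: IH => //; exact: leq_trans (leq_addl _ _) qQn.
Qed.

Lemma nth_cat_cons_neq T (x0 x y : T) s t i : i != size s ->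
  nth x0 (s ++ x :: t) i = nth x0 (s ++ y :: t) i.
Proof.
rewrite !nth_cat; case: ltnP => // si; rewrite neq_ltn ltnNge si /= => lt_si.
by rewrite -(subnSK lt_si).
Qed.

Lemma sorted_slt (C : eqType) (le : rel C) (s : seq C) : well_order le ->
  uniq s -> sorted le s -> sorted (slt le) s.
Proof.
move=> le_wo; case: s => //= x s; elim: s x => //= y s IH x.
rewrite inE negb_or -andbA => /and3P[xy _ ys] /andP[lexy les].
by rewrite slt_neqle // xy lexy IH.
Qed.

Section GenericSet.
Variables (R : realType) (R_regular : regular_card [set: R]).
Variables (X : set ZN) (X_luzin : c_luzin R X).
Variables (le : rel R) (le_wo : well_order le).
Hypothesis le_small : forall i, small R [set j | slt le j i].
Variable e : R -> bool * (nat -> int) * code.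
Hypothesis e_surj : forall r, exists i, e i = r.

Let lt := slt le.
Let flag i := (e i).1.1.
Let ecode i := (e i).2.

Variable z : R -> nat -> int.
Hypothesis z_generic : forall i, generic lt ecode z i.
Hypothesis z_shift : forall i,
  exists2 x : ZN, X x & z i = (fun n => x n + (e i).1.2 n)%R.

Let R_pow := @set_nat_le_realType R.
Let lt_trans : transitive lt := slt_trans le_wo.

Lemma small_le i : small R [set j | le j i].
Proof.
have := smallU R_regular R_pow (@le_small i) (@small1 _ R_pow _ i).
apply: small_subset.
move=> j /= ji; have [->|ij] := eqVneq j i; [by right|left].
by rewrite /= slt_neqle ?ij.
Qed.

(** The stages with flag [b] carry all shifts, so they map onto Z^N, which contains [X]. *)
Lemma flag_not_small b : ~ small R [set i | flag i = b].
Proof.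
move=> /(small_image (f := fun i => (e i).1.2)) sb.
apply: luzin_not_small X_luzin _; apply: small_subset sb => x _.
by have [i ei] := e_surj (b, x, set0); exists i; rewrite /= ?/flag ei.
Qed.

(** By regularity, countably many initial segments have a small union. *)
Lemma flag_cofinal b (s : nat -> R) :
  exists2 i, flag i = b & forall n, lt (s n) i.
Proof.
apply: contrapT => nob; apply: (@flag_not_small b).
apply: (@small_subset _ _ _ (\bigcup_n [set j | le j (s n)])); last first.
  by apply: small_bigcup_nat => // n; exact: small_le.
move=> i bi; apply: contrapT => nle; apply: nob; exists i => // n.
by apply/negP => ile; apply: nle; exists n.
Qed.

Lemma codes_known b (s : nat -> code) :
  exists2 i, flag i = b & forall n, known lt ecode z i (s n).
Proof.
have [t et] := choice (fun n => e_surj (true, cst 0%R, s n)).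
have [i bi ti] := flag_cofinal b t; exists i => // n.
by have := known_base ecode z (ti n); rewrite /ecode et.
Qed.

(** The boxes missing [N n] form a dense code; past a stage that knows all these codes, every [z j]
    avoids [M]. *)
Lemma small_meager_preimage (M : set ZN) : meager M ->
  small R [set i | M (z i)].
Proof.
move=> [N N_nwd ->].
pose c n : code :=
  [set Q | exists2 s, Q = [:: s] & forall a, N n a -> ~~ starts a s].
have [i _ ic] := codes_known true c.
apply: small_subset (@small_le i) => j [n _ Nzj].
apply/negP => /negP ij; have jc := known_mono lt_trans ij (ic n).
have c_dense : code_dense 1 (c n).
  move=> [//|s [|//]] _; have [s' ss' Ns'] := (nowhere_denseP _).1 (N_nwd n) s.
  by exists [:: s']; [exists s'|rewrite /refines /= ss'].
have [[|//] [m [s [<-] Ns]] _] :=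
  z_generic jc c_dense (erefl : size [::] = 0%N).
by have := Ns _ Nzj; rewrite starts_mkseq.
Qed.

Definition generic_set : set ZN := [set z i | i in [set i | flag i]].
Local Notation Y := generic_set.

Lemma meager_set1 (a : ZN) : meager [set a].
Proof.
exists (fun=> [set a]) => [_|]; last by rewrite bigcup_const //; exists 0%N.
apply/nowhere_denseP => s; exists (rcons s (a (size s) + 1)%R).
  exact: prefix_rcons.
move=> _ ->; apply/negP => /eqP; rewrite size_rcons mkseqS => /rcons_inj[_].
by move=> /eqP; rewrite -subr_eq0 addrAC subrr add0r oner_eq0.
Qed.

(** Singletons are meager, so each value of [z] is taken at a small set of stages only. *)
Lemma generic_set_le : [set: R] #<= Y.
Proof.
apply: contrapT => sY; apply: (@flag_not_small true).
apply: (@small_subset _ _ _ (\bigcup_(y in Y) [set i | z i = y])).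
  by move=> i fi; exists (z i) => //; exists i.
apply: small_bigcup => // [|y _].
  exact: card_le_trans (card_leT _) (ZN_le R).
apply: small_subset (small_meager_preimage (meager_set1 y)) => i; exact.
Qed.

Lemma c_luzin_generic_set : c_luzin R Y.
Proof.
split=> [|M M_meager]; first exact: generic_set_le.
split; first exact: card_le_trans (card_leT _) (ZN_le R).
apply: small_subset (small_image (f := z) (small_meager_preimage M_meager)).
by move=> _ [[i fi <-] Mi]; exists i.
Qed.

Lemma open_coordinate (S : topologicalType) (f : S -> ZN) n (V : set int) :
  continuous f -> open [set p | V (f p n)].
Proof.
move=> f_cont.
have -> : [set p | V (f p n)] =
  f @^-1` (@proj nat (fun=> discrete_topology int) n @^-1` V) by [].
apply: open_comp; first by move=> ? _; exact: f_cont.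
apply: open_comp; last exact: discrete_open.
by move=> ? _; exact: proj_continuous.
Qed.

Lemma not_Menger_generic_set : ~ Menger (set_type X * set_type Y)%type.
Proof.
pose T := (set_type X * set_type Y)%type.
pose diff n (p : T) : int := (val p.2 n - val p.1 n)%R.
pose A n (m : int) : set T := [set p | diff n p = m].
have A_open n m : open (A n m).
  have -> : A n m = \bigcup_k ([set p : T | (val p.1 : ZN) n = k] `&`
                               [set p : T | (val p.2 : ZN) n = (k + m)%R]).
    apply/seteqP; split=> [p|p [k _ [/= pk pm]]].
      move=> pm; exists (val p.1 n) => //; split=> //=.
      by rewrite -pm /diff addrC subrK.
    by rewrite /A /diff /= pk pm addrAC subrr add0r.
  apply: bigcup_open => k _; apply: openI.
    apply: (@open_coordinate T (fun p => val p.1) n [set k]).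
    move=> p; apply: continuous_comp; first exact: cvg_fst.
    exact: initial_continuous.
  apply: (@open_coordinate T (fun p => val p.2) n [set (k + m)%R]).
  move=> p; apply: continuous_comp; first exact: cvg_snd.
  exact: initial_continuous.
move=> /(_ (fun n => range (A n))) [n|F F_fin].
  split; first by move=> _ [m _ <-].
  by apply/seteqP; split=> // p _; exists (A n (diff n p)).
have /choice[f fF] n : exists m, forall G p, F n G -> G p -> diff n p <> m.
  have [Fn_fin FU] := F_fin n; apply: contrapT => /forallNP nm.
  (* [diff n] is constant on each member of the finite family [F n]; an empty member gets the
     default 0. *)
  pose value (G : set T) : int := if pselect (exists p, G p) is left Gp
    then diff n (sval (cid Gp)) else 0%R.
  apply: infinite_nat; apply: card_le_finite (finite_image value Fn_fin).
  apply: (@inj_card_le _ _ Posz) => [? ? _ _ []//|m _].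
  apply: contrapT => nFm; apply: (nm m) => G p FG Gp pm; apply: nFm.
  exists G => //; rewrite /value; case: pselect => [Gq|[]]; last by exists p.
  case: cid => q /=; have [m' _ GE] := FU _ FG.
  by move: Gp pm; rewrite -GE => <- <-.
(* At this stage [z i - x = f], which gives a point of the product in no selected set. *)
have [i ei] := e_surj (true, f, set0).
have [x Xx zx] := z_shift i.
have Yz : Y (z i) by exists i; rewrite //= /flag ei.
pose p : T := (exist _ x (mem_set Xx), exist _ (z i : ZN) (mem_set Yz)).
move=> /seteqP[_ /(_ p I)[G [n _ FG] Gp]].
by apply: (fF n _ _ FG Gp); rewrite /diff /= zx ei /= addrAC subrr add0r.
Qed.

Lemma Rothberger_generic_set k : Rothberger {ptws 'I_k -> set_type Y}.
Proof.
move=> U U_cover.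
(* A point [t0] of the power provides a member of the cover to select when none contains the box. *)
have [i0 fi0] := e_surj (true, cst 0%R, set0).
have Yz0 : Y (z i0) by exists i0; rewrite //= /flag fi0.
pose t0 : 'I_k -> set_type Y := fun=> exist _ (z i0 : ZN) (mem_set Yz0).
pose inside b (A : set {ptws 'I_k -> set_type Y}) :=
  forall t : 'I_k -> set_type Y,
    (forall j, starts (val (t j)) (nth [::] b j)) -> A t.
have /choice[A /all_and2[UA inA]] (ib : nat * seq (seq int)) : exists A,
    U ib.1 A /\ ((exists2 A', U ib.1 A' & inside ib.2 A') -> inside ib.2 A).
  have [[A' UA' inA']|nA'] := pselect (exists2 A', U ib.1 A' & inside ib.2 A').
    by exists A'.
  have [_ /seteqP[_ /(_ t0 I)[A UA _]]] := U_cover ib.1.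
  by exists A; split=> // /nA'.
pose box (m : int) : seq (seq int) := odflt [::] (unpickle `|m|%N).
have boxK b : box (Posz (pickle b)) = b by rewrite /box absz_nat pickleK.
(* In the increasing tuple formed by the coordinates of [t] and the selector,
   [pe.1] lists the positions of the former and [pe.2] is that of the latter. *)
pose c (pe : seq nat * nat) : code := [set Q | exists i,
  let b := box (nth 0%R (nth [::] Q pe.2) i) in
  [/\ (i < size (nth [::] Q pe.2))%N, exists2 A', U i A' & inside b A' &
      forall j : 'I_k, prefix (nth [::] b j) (nth [::] Q (nth 0%N pe.1 j))]].
(* The selector has flag [false], so its stage differs from those of the coordinates of [t]. *)
have [g fg gc] :=
  codes_known false (fun n => c (odflt ([::], 0%N) (unpickle n))).
have {}gc pe : known lt ecode z g (c pe).
  by have := gc (pickle pe); rewrite pickleK.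
exists (fun i => A (i, box (z g i))) => [i|]; first exact: (UA (i, _)).
apply/seteqP; split=> // t _.
have /choice[a a_t] (j : 'I_k) : exists i, flag i /\ z i = val (t j).
  have [i fi zi] : Y (val (t j)) by apply: set_mem; exact: valP.
  by exists i.
have ag j : a j != g.
  by apply: contraPneq fg => <-; rewrite (a_t j).1.
(* Coordinates before stage [g] get fixed; the later ones, sorted without repetition, follow [g] in
   the increasing tuple. *)
pose s := [seq i <- codom a | lt i g].
pose u := sort le (undup [seq i <- codom a | lt g i]).
have path_u : path lt g u.
  rewrite path_min_sorted.
    by apply: (sorted_slt le_wo); rewrite ?sort_uniq ?undup_uniq //;
      exact: sort_sorted (well_order_total le_wo) _.
  by apply/allP => i; rewrite mem_sort mem_undup mem_filter => /andP[].
have mem_a j : a j \in s ++ g :: u.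
  rewrite mem_cat inE mem_sort mem_undup !mem_filter codom_f !andbT.
  rewrite (negbTE (ag j)).
  rewrite /= /lt !slt_neqle // ag eq_sym ag /=.
  exact: (well_order_total le_wo).
pose p := [seq index (a j) (s ++ g :: u) | j <- enum 'I_k].
have pE (j : 'I_k) : nth 0%N p j = index (a j) (s ++ g :: u).
  by rewrite (nth_map j) ?size_enum_ord // nth_ord_enum.
have p_s (j : 'I_k) : nth 0%N p j != size s.
  apply: contraTneq (ag j) => pjs.
  by rewrite negbK -(nth_index g (mem_a j)) -pE pjs nth_cat ltnn subnn.
have [|Q zQ cQ] :=
  generic_decide lt_trans z_generic (s := s) _ path_u (gc (p, size s)).
  exact: filter_all.
pose L := s ++ g :: u.
have L_at x : x \in L -> (index x L < size L)%N by rewrite index_mem.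
(* In the first case entry [i] of [z g] names a box around [t], so the set selected from [U i]
   contains [t]. *)
case: cQ => [[B zB [i /= [lti iA' pre]]]|ext].
  exists i => //; have zL : in_box (map z L) (B ++ Q).
    by rewrite map_cat; exact: in_box_cat.
  have zLg : starts (z g) (nth [::] (B ++ Q) (size s)).
    have sL : (size s < size L)%N by rewrite size_cat /= addnS ltnS leq_addr.
    have := in_box_nth (z g) zL (i := size s); rewrite size_map (nth_map g) //.
    have -> : nth g L (size s) = g by rewrite nth_cat ltnn subnn.
    exact.
  have gi : nth 0%R (nth [::] (B ++ Q) (size s)) i = z g i.
    by rewrite [in LHS](eqP zLg) nth_mkseq.
  rewrite gi in iA' pre; apply: (inA (i, _) iA') => j.
  apply: starts_prefix (pre j) _; rewrite pE -(a_t j).2.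
  have := in_box_nth (z g) zL (i := index (a j) L).
  by rewrite size_map (nth_map g) ?L_at // nth_index //; exact.
(* In the exterior case, extending the initial segment [r] of [z g] by the number of a box around
   [t] inside a member of [U i] yields a box of the code, a contradiction. *)
case: Q zQ ext => [|r Q] //= /andP[zr zQ] ext; exfalso.
pose i := size r.
have [UiO /seteqP[_ /(_ t I)[A' UA' A't]]] := U_cover i.
have /nbhs_ptws_ZN[n nA'] : nbhs t A'.
  by apply: open_nbhs_nbhs; split=> //; exact: UiO.
pose b := [seq mkseq (val (t j) : ZN) n | j <- enum 'I_k].
have bE (j : 'I_k) : nth [::] b j = mkseq (val (t j) : ZN) n.
  by rewrite (nth_map j) ?size_enum_ord // nth_ord_enum.
have bA' : inside b A'.
  move=> t' t'b; apply: nA' => j; have /eqP := t'b j.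
  by rewrite bE size_mkseq.
(* Length [N] suffices both to refine [Q] and to show [n] entries of every coordinate of [t]. *)
pose N := (n + sumn (map size Q))%N; pose boxN := map (fun x => mkseq (z x) N).
have boxNE v : boxN v = [seq mkseq w N | w <- map z v] by rewrite -map_comp.
apply: (ext (boxN s) (rcons r (Posz (pickle b)) :: boxN u)).
- by rewrite boxNE; exact: in_box_mkseq.
- rewrite /refines /= prefix_rcons /= boxNE.
  by apply: in_box_refines_mkseq => //; exact: leq_addl.
have ng : nth [::] (boxN s ++ rcons r (Posz (pickle b)) :: boxN u) (size s) =
    rcons r (Posz (pickle b)).
  by rewrite nth_cat size_map ltnn subnn.
exists i; rewrite /= ng nth_rcons ltnn eqxx boxK size_rcons; split=> // [|j].
  by exists A'.
rewrite bE pE (@nth_cat_cons_neq _ _ _ (mkseq (z g) N)); last first.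
  by rewrite size_map -pE.
rewrite -[_ :: boxN u]/(boxN (g :: u)) -map_cat (nth_map g) ?L_at //.
rewrite nth_index //.
rewrite (a_t j).2; apply: starts_prefix_mkseq; first exact: starts_mkseq.
by rewrite size_mkseq leq_addr.
Qed.

End GenericSet.

(* [set_type X] is X with the subspace topology inherited from Z^N. *)
Theorem theorem3p2 (R : realType)
    (cov_eq_c : is_cov_meager (R : Type) [set: R])
    (c_regular : regular_card [set: R])
    (X : set ZN) (X_luzin : c_luzin R X) :
  exists Y : set ZN,
    [/\ c_luzin R Y,
        forall n : nat, Rothberger {ptws 'I_n -> set_type Y} &
        ~ Menger (set_type X * set_type Y)%type].
Proof.
have [le le_wo le_small] := short_well_order R.
have [e e_surj] := enum_requests R.
have [z /all_and2[z_generic z_shift]] :=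
  generic_sequence c_regular X_luzin le_wo le_small e.
exists (generic_set e z); split.
- exact: (c_luzin_generic_set c_regular X_luzin le_wo).
- exact: (Rothberger_generic_set c_regular X_luzin le_wo).
- exact: (not_Menger_generic_set e_surj).
Qed.
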